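(* There exists a group $G$ that is of type $FP_2(\mathbb{Q})$ but not of type $FP_2(\mathbb{Z}/p\mathbb{Z})$ for any prime $p$.
   Context: A group $G$ is of type $FP_n(R)$, for a ring $R$, if there is an exact sequence $P_n\to\dots\to P_1\to P_0\to R\to 0$ of projective $RG$-modules such that each $P_i$ is finitely generated, where $R$ is the trivial $RG$-module. *)

(* Defs.v *)
From HB Require Import structures.
From mathcomp Require Import all_boot all_order all_algebra.
From mathcomp Require Import finmap monalg.

Set Implicit Arguments.
Unset Strict Implicit.
Unset Printing Implicit Defensive.

Import GRing.Theory.
Local Open Scope fset_scope.
Local Open Scope ring_scope.

(* The group ring RG: finitely supported functions from G to R. The product of
   {malg R[G]} is not reused, because it requires the keys to form a monoid in
   which x * y = 1 implies x = y = 1; only its additive group is. *)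
Definition group_ring (R : pzRingType) (G : groupType) : Type := {malg R[G]}.

HB.instance Definition _ (R : pzRingType) (G : groupType) :=
  GRing.Zmodule.copy (group_ring R G) {malg R[G]}.

Section GroupRing.
Context (R : pzRingType) (G : groupType).
Implicit Types (a b c : group_ring R G) (r s : R) (x y : G).

Definition group_ring_one : group_ring R G := << 1 *g 1%g >>.

Definition group_ring_mul a b : group_ring R G :=
  \sum_(x <- msupp a) \sum_(y <- msupp b) << a@_x * b@_y *g (x * y)%g >>.

Definition augmentation a : R := \sum_(x <- msupp a) a@_x.

Lemma group_ring_mulEw (d1 d2 : {fset G}) a b :
    msupp a `<=` d1 -> msupp b `<=` d2 ->
  group_ring_mul a b =
    \sum_(x <- d1) \sum_(y <- d2) << a@_x * b@_y *g (x * y)%g >>.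
Proof.
move=> le1 le2; rewrite /group_ring_mul (big_fset_incl _ le1) /=.
  apply/eq_bigr=> x _; apply/big_fset_incl => // y _ /mcoeff_outdom ->.
  by rewrite mulr0 monalgU0.
move=> x _ /mcoeff_outdom ax.
by rewrite big1 // => y _; rewrite ax mul0r monalgU0.
Qed.

Lemma group_ring_mulUU r s x y :
  group_ring_mul << r *g x >> << s *g y >> = << r * s *g (x * y)%g >>.
Proof.
by rewrite (group_ring_mulEw msuppU_le msuppU_le) !big_seq_fset1 !mcoeffUU.
Qed.

Lemma group_ring_mulDl : left_distributive group_ring_mul +%R.
Proof.
move=> a b c.
rewrite (group_ring_mulEw (msuppD_le a b) (fsubset_refl _)).
rewrite (group_ring_mulEw (fsubsetUl (msupp a) (msupp b)) (fsubset_refl _)).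
rewrite (group_ring_mulEw (fsubsetUr (msupp a) (msupp b)) (fsubset_refl _)).
rewrite -big_split /=; apply/eq_bigr=> x _.
rewrite -big_split /=; apply/eq_bigr=> y _.
by rewrite mcoeffD mulrDl monalgUD.
Qed.

Lemma group_ring_mulDr : right_distributive group_ring_mul +%R.
Proof.
move=> c a b.
rewrite (group_ring_mulEw (fsubset_refl _) (msuppD_le a b)).
rewrite (group_ring_mulEw (fsubset_refl _) (fsubsetUl (msupp a) (msupp b))).
rewrite (group_ring_mulEw (fsubset_refl _) (fsubsetUr (msupp a) (msupp b))).
rewrite -big_split /=; apply/eq_bigr=> x _.
rewrite -big_split /=; apply/eq_bigr=> y _.
by rewrite mcoeffD mulrDr monalgUD.
Qed.

Lemma group_ring_mul0r : left_zero 0 group_ring_mul.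
Proof. by move=> a; rewrite /group_ring_mul msupp0 big_seq_fset0. Qed.

Lemma group_ring_mulr0 : right_zero 0 group_ring_mul.
Proof.
by move=> a; rewrite /group_ring_mul big1 // => x _; rewrite msupp0 big_seq_fset0.
Qed.

Lemma group_ring_mul_suml (I : Type) (s : seq I) (F : I -> group_ring R G) a :
  group_ring_mul (\sum_(i <- s) F i) a = \sum_(i <- s) group_ring_mul (F i) a.
Proof.
exact: (big_morph (group_ring_mul^~ a) (fun _ _ => group_ring_mulDl _ _ _)
  (group_ring_mul0r _)).
Qed.

Lemma group_ring_mul_sumr (I : Type) (s : seq I) (F : I -> group_ring R G) a :
  group_ring_mul a (\sum_(i <- s) F i) = \sum_(i <- s) group_ring_mul a (F i).
Proof.
exact: (big_morph (group_ring_mul a) (fun _ _ => group_ring_mulDr _ _ _)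
  (group_ring_mulr0 _)).
Qed.

Lemma group_ring_mulA : associative group_ring_mul.
Proof.
move: group_ring_mul group_ring_mul_suml group_ring_mul_sumr group_ring_mulUU.
move=> mul mul_suml mul_sumr mulUU a b c.
rewrite (monalgE a) (monalgE b) (monalgE c) !mul_suml; apply/eq_bigr=> x _.
rewrite !(mul_sumr _ (msupp b)) mul_suml; apply/eq_bigr=> y _.
rewrite !mul_sumr; apply/eq_bigr=> z _.
by rewrite !mulUU mulrA mulgA.
Qed.

Lemma group_ring_mul1r : left_id group_ring_one group_ring_mul.
Proof.
move=> a; rewrite [a in LHS]monalgE group_ring_mul_sumr [RHS]monalgE.
by apply/eq_bigr=> x _; rewrite group_ring_mulUU mul1r mul1g.
Qed.

Lemma group_ring_mulr1 : right_id group_ring_one group_ring_mul.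
Proof.
move=> a; rewrite [a in LHS]monalgE group_ring_mul_suml [RHS]monalgE.
by apply/eq_bigr=> x _; rewrite group_ring_mulUU mulr1 mulg1.
Qed.

HB.instance Definition _ := GRing.Zmodule_isPzRing.Build (group_ring R G)
  group_ring_mulA group_ring_mul1r group_ring_mulr1
  group_ring_mulDl group_ring_mulDr.

Lemma augmentationEw (d : {fset G}) a :
  msupp a `<=` d -> augmentation a = \sum_(x <- d) a@_x.
Proof.
by move=> le; apply: big_fset_incl => // x _ /mcoeff_outdom ->.
Qed.

Lemma augmentationU r x : augmentation << r *g x >> = r.
Proof. by rewrite (augmentationEw msuppU_le) big_seq_fset1 mcoeffUU. Qed.

Lemma augmentation1 : augmentation 1 = 1.
Proof. exact: augmentationU. Qed.

Lemma augmentationD : {morph augmentation : a b / a + b}.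
Proof.
move=> a b; rewrite (augmentationEw (msuppD_le a b)).
rewrite (augmentationEw (fsubsetUl (msupp a) (msupp b))).
rewrite (augmentationEw (fsubsetUr (msupp a) (msupp b))).
by rewrite -big_split /=; apply/eq_bigr=> x _; rewrite mcoeffD.
Qed.

Lemma augmentation0 : augmentation 0 = 0.
Proof. by rewrite /augmentation msupp0 big_seq_fset0. Qed.

Lemma augmentation_sum (I : Type) (s : seq I) (F : I -> group_ring R G) :
  augmentation (\sum_(i <- s) F i) = \sum_(i <- s) augmentation (F i).
Proof. exact: (big_morph augmentation augmentationD augmentation0). Qed.

Lemma augmentationM : {morph augmentation : a b / a * b}.
Proof.
move=> a b; rewrite [a * b]/(group_ring_mul a b) augmentation_sum.
rewrite [augmentation a in RHS]/augmentation mulr_suml; apply/eq_bigr=> x _.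
rewrite augmentation_sum mulr_sumr; apply/eq_bigr=> y _.
by rewrite augmentationU.
Qed.

End GroupRing.

(* The trivial RG-module R: the action of an element of RG is multiplication by
   the sum of its coefficients, so every element of G acts as the identity. *)
Definition trivial_module (R : pzRingType) (G : groupType) : Type := R.

HB.instance Definition _ (R : pzRingType) (G : groupType) :=
  GRing.Zmodule.copy (trivial_module R G) R.

Section TrivialModule.
Context (R : pzRingType) (G : groupType).
Implicit Types (a b : group_ring R G) (m n : trivial_module R G).

Definition trivial_scale a m : trivial_module R G :=
  augmentation a * (m : R).

Lemma trivial_scaleA a b m :
  trivial_scale a (trivial_scale b m) = trivial_scale (a * b) m.
Proof. by rewrite /trivial_scale augmentationM mulrA. Qed.

Lemma trivial_scale1 : left_id 1 trivial_scale.
Proof. by move=> m; rewrite /trivial_scale augmentation1 mul1r. Qed.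

Lemma trivial_scaleDr : right_distributive trivial_scale +%R.
Proof. by move=> a m n; rewrite /trivial_scale mulrDr. Qed.

Lemma trivial_scaleDl m : {morph trivial_scale^~ m : a b / a + b}.
Proof. by move=> a b; rewrite /trivial_scale augmentationD mulrDl. Qed.

HB.instance Definition _ :=
  GRing.Zmodule_isLmodule.Build (group_ring R G) (trivial_module R G)
    trivial_scaleA trivial_scale1 trivial_scaleDr trivial_scaleDl.

End TrivialModule.

Definition surjective (S T : Type) (f : S -> T) : Prop :=
  forall y, exists x, f x = y.

Definition exact_at (S T : Type) (U : nmodType) (f : S -> T) (g : T -> U) : Prop :=
  forall y, g y = 0 <-> exists x, f x = y.

Definition finitely_generated (A : pzRingType) (M : lmodType A) : Prop :=
  exists (n : nat) (e : 'I_n -> M),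
    forall x, exists c : 'I_n -> A, x = \sum_(i < n) c i *: e i.

Definition projective (A : pzRingType) (P : lmodType A) : Prop :=
  forall (M N : lmodType A) (f : {linear M -> N}) (g : {linear P -> N}),
    surjective f -> exists h : {linear P -> M}, forall x, f (h x) = g x.

(* The sequence P_n -> ... -> P_0 -> R -> 0 is exact at P_0, ..., P_(n-1) and R;
   nothing is required at P_n. The modules and maps are indexed by all of nat,
   but those beyond P_n are unconstrained. *)
Definition type_FP (n : nat) (R : pzRingType) (G : groupType) : Prop :=
  exists (P : nat -> lmodType (group_ring R G))
         (d : forall i, {linear P i.+1 -> P i})
         (eps : {linear P 0%N -> trivial_module R G}),
    [/\ forall i, (i <= n)%N -> projective (P i) /\ finitely_generated (P i),
        surjective eps,
        (0 < n)%N -> exact_at (d 0%N) eps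
      & forall i, (i.+1 < n)%N -> exact_at (d i.+1) (d i)].

(* Main.v *)
From HB Require Import structures.
Require Import Defs.
From mathcomp Require Import all_boot all_order all_algebra.
From mathcomp Require Import finmap monalg.
From mathcomp.classical Require Import boolp.

(** The group is the quotient of a finitely presented group K by elements
    r_1, r_2, ... such that r_n has order dividing n in K.

    Over the rationals the r_n are invisible. The module of relations of a
    presentation, tensored with a field F, is what has to be finitely generated,
    and a relator with k-th power a consequence of the other relators contributes
    nothing to it when k is invertible in F. Hence the finite presentation of K
    already yields a free resolution of length two of the trivial QG-module Q
    ([type_FP2_of_presentation]).

    Over the field with p elements each r_n with n divisible by p counts: there is
    a quotient of K in which r_n is central of order p while all other r_m are
    trivial. This gives infinitely many linearly independent F_p-valued
    functionals on the relations of G that are invariant under conjugation. If G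
    were of type FP_2 over F_p, the relations would be generated as a module by
    some d elements, and the invariant functionals would form a space of dimension
    at most d ([type_FP2_bound]).

    The group K comes from a ring. In a ring with elements s, x, y, z such that
    s x = x s + x, y s = 0 and s z = 0, moving s through x^n gives
    0 = y s x^n z = y x^n s z + n y x^n z = n y x^n z, so that three relations
    produce torsion of unbounded order. To turn it into a group, take elements
    e_ij(a), for i and j among five indices and a one of the four letters, subject
    to Steinberg relations: e_ij(a) and e_kl(b) commute when j <> k and i <> l, and
    [e_ij(a), e_jk(b)] does not depend on j, so that it may be called e_ik(ab).
    With five indices finitely many of these relations imply the corresponding
    ones for arbitrary words in the letters ([root_induction], [root_cat]). The
    computation in the ring then becomes r_n^n = 1 for r_n = e_01(y x^n z)
    ([root_torsion]).

    Conversely, over a field where n = 0 the ring acts on a space of dimension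
    n + 3 in such a way that y x^n z is a non-zero matrix unit v killed on both
    sides by all letters, while y x^m z = 0 for m <> n ([chain_rep_torsion]). Then
    e_ij(a) acts by the elementary matrix 1 + a E_ij of size five over this ring,
    and r_n by the central element 1 + v E_01. *)

Set Implicit Arguments.
Unset Strict Implicit.
Unset Printing Implicit Defensive.

Import GRing.Theory.
Local Open Scope fset_scope.
Local Open Scope ring_scope.

(** * Lifting maps and comparing free presentations *)

Section Combination.
Context (A : pzRingType) (M : lmodType A) (n : nat).

Definition combination (m : 'I_n -> M) (u : 'rV[A]_n) : M :=
  \sum_i u 0 i *: m i.

Lemma combination_is_linear m : linear (combination m).
Proof.
move=> a u v; rewrite /combination scaler_sumr -big_split /=.
by apply: eq_bigr => i _; rewrite !mxE scalerDl scalerA.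
Qed.

HB.instance Definition _ m :=
  GRing.isLinear.Build A 'rV[A]_n M _ (combination m) (combination_is_linear m).

Lemma combination_delta m i : combination m 'e_i = m i.
Proof.
rewrite /combination (bigD1 i) //= big1 => [|j /negPf ji].
  by rewrite mxE !eqxx scale1r addr0.
by rewrite mxE ji andbF scale0r.
Qed.

End Combination.

Lemma linear_combination (A : pzRingType) (M N : lmodType A) n
    (f : {linear M -> N}) (m : 'I_n -> M) u :
  f (combination m u) = combination (f \o m) u.
Proof. by rewrite linear_sum; apply: eq_bigr => i _; rewrite linearZ. Qed.

Lemma linear_row_combination (A : pzRingType) (M : lmodType A) n
    (f : {linear 'rV[A]_n -> M}) u :
  f u = combination (fun i => f 'e_i) u.
Proof.
rewrite {1}[u]row_sum_delta linear_sum.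
by apply: eq_bigr => i _; rewrite linearZ.
Qed.

Lemma row_lift (A : pzRingType) (M N : lmodType A) n (f : {linear M -> N})
    (g : {linear 'rV[A]_n -> N}) :
  (forall u, exists x, f x = g u) ->
  exists h : {linear 'rV[A]_n -> M}, forall u, f (h u) = g u.
Proof.
move=> fg; have [m fm] := fin_all_exists (fun i => fg 'e_i).
exists (combination m : {linear _ -> _}) => u /=.
rewrite linear_combination linear_row_combination.
by apply: eq_bigr => i _; rewrite /= fm.
Qed.

Lemma row_projective (A : pzRingType) n : projective 'rV[A]_n.
Proof. by move=> M N f g f_surj; apply: row_lift => u; apply: f_surj. Qed.

Lemma row_finitely_generated (A : pzRingType) n : finitely_generated 'rV[A]_n.
Proof.
exists n, (fun i => 'e_i) => u; exists (fun i => u 0 i).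
exact: row_sum_delta.
Qed.

(** Projectivity alone lifts along surjections onto the whole of [N]. A finitely
    generated projective is a retract of a free module, and this replaces the
    surjectivity of [f] by the inclusion of the image of [g] in that of [f],
    without ever making that image into a module. *)
Lemma projective_lift (A : pzRingType) (P M N : lmodType A)
    (f : {linear M -> N}) (g : {linear P -> N}) :
  projective P -> finitely_generated P ->
  (forall x, exists y, f y = g x) ->
  exists h : {linear P -> M}, forall x, f (h x) = g x.
Proof.
move=> projP [n [e gen]] fg.
have [|s es] := projP _ _ (combination e : {linear _ -> _}) idfun.
  move=> x; have [c xE] := gen x; exists (\row_i c i); rewrite [RHS]xE.
  by apply: eq_bigr => i _; rewrite mxE.
have [|h fh] := @row_lift _ _ _ _ f (g \o combination e : {linear _ -> _}).
  by move=> u; apply: fg.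
exists (h \o s : {linear _ -> _}) => x /=.
by rewrite fh /= es.
Qed.

(** A form of Schanuel's lemma. Compare the two resolutions by chain maps [f] and
    [g] in both directions, and let [h] be a homotopy from [f g] to the identity
    in degree 0. A cycle [u] is the sum of [q u = u - f g u - h b u], a linear
    function of [u], and of [f g u], where [g u] is a cycle and so comes from
    [P2]: the values of [q] on the basis and the images of the generators of [P2]
    generate. *)
Lemma cycles_finitely_generated (A : pzRingType) (M P0 P1 P2 : lmodType A)
    (d1 : {linear P2 -> P1}) (d0 : {linear P1 -> P0}) (eps : {linear P0 -> M})
    (n0 n1 : nat) (b : {linear 'rV[A]_n1 -> 'rV[A]_n0})
    (eta : {linear 'rV[A]_n0 -> M}) :
  projective P0 -> finitely_generated P0 ->
  projective P1 -> finitely_generated P1 -> finitely_generated P2 ->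
  surjective eps -> exact_at d0 eps -> exact_at d1 d0 ->
  surjective eta -> exact_at b eta ->
  exists (d : nat) (z : 'I_d -> 'rV[A]_n1),
    (forall t, b (z t) = 0) /\
    forall u, b u = 0 -> exists c, u = combination z c.
Proof.
move=> projP0 fgP0 projP1 fgP1 [k [e gen]] eps_surj ex0 ex1 eta_surj exb.
have epsd x : eps (d0 x) = 0 by apply/ex0; exists x.
have dd x : d0 (d1 x) = 0 by apply/ex1; exists x.
have etab x : eta (b x) = 0 by apply/exb; exists x.
have [|f0 f0E] := @projective_lift _ P0 _ _ eta eps projP0 fgP0.
  by move=> x; apply: eta_surj.
have [|f1 f1E] := @projective_lift _ P1 _ _ b (f0 \o d0 : {linear _ -> _}) projP1 fgP1.
  by move=> x; apply/exb; rewrite /= f0E.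
have [|g0 g0E] := row_lift (f := eps) (g := eta).
  by move=> x; apply: eps_surj.
have [|g1 g1E] := row_lift (f := d0) (g := (g0 \o b : {linear _ -> _})).
  by move=> x; apply/ex0; rewrite /= g0E.
have [|h hE] := row_lift (f := b) (g := (idfun \- (f0 \o g0) : {linear _ -> _})).
  by move=> x; apply/exb; rewrite /= linearB /= f0E g0E subrr.
pose q : {linear 'rV[A]_n1 -> 'rV[A]_n1} :=
  ((idfun \- (f1 \o g1)) \- (h \o b)).
have bq u : b (q u) = 0.
  by rewrite /q /= !linearB /= f1E hE /= g1E /= subrr.
exists (n1 + k)%N, (fun t => match split t with
  | inl i => q 'e_i | inr j => f1 (d1 (e j)) end).
split=> [t|u bu0].
  by case: (split t) => [i|j] //; rewrite f1E /= dd linear0.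
have [x g1uE] : exists x, d1 x = g1 u.
  by apply/ex1; rewrite g1E /= bu0 linear0.
have [c xE] := gen x.
exists (row_mx u (\row_j c j)); rewrite /combination big_split_ord /=.
transitivity (q u + f1 (g1 u)); first by rewrite /q /= bu0 linear0 subr0 subrK.
congr (_ + _).
  rewrite [LHS]linear_row_combination; apply: eq_bigr => i _.
  by rewrite row_mxEl (unsplitK (inl i)).
rewrite -g1uE xE !linear_sum; apply: eq_bigr => j _.
by rewrite row_mxEr mxE !linearZ (unsplitK (inr j)).
Qed.

(** * Groups given by generators and relators *)

Section Words.
Context (X : choiceType).

Definition word := seq (X * bool).

Implicit Types (u v w r : word) (Rel : word -> Prop).

Definition inverse_word w : word := rev [seq (l.1, ~~ l.2) | l <- w].

Definition commutator_word u v : word :=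
  inverse_word u ++ inverse_word v ++ u ++ v.

Lemma inverse_word_cat u v :
  inverse_word (u ++ v) = inverse_word v ++ inverse_word u.
Proof. by rewrite /inverse_word map_cat rev_cat. Qed.

Lemma inverse_wordK : involutive inverse_word.
Proof.
move=> w; rewrite /inverse_word map_rev revK -map_comp.
by rewrite map_id_in // => -[x b] _ /=; rewrite negbK.
Qed.

Definition cancellation (l : X * bool) : word := [:: l; (l.1, ~~ l.2)].

(** The congruence is generated without forming a free group first: cancelling
    pairs are inserted and deleted like relators. *)
Inductive conv Rel : word -> word -> Prop :=
| conv_refl w : conv Rel w w
| conv_sym u v : conv Rel u v -> conv Rel v u
| conv_trans u v w : conv Rel u v -> conv Rel v w -> conv Rel u w
| conv_cancel u l v : conv Rel (u ++ cancellation l ++ v) (u ++ v)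
| conv_relator u r v : Rel r -> conv Rel (u ++ r ++ v) (u ++ v).

Section Congruence.
Context (Rel : word -> Prop).

Lemma conv_cat u u' v v' :
  conv Rel u u' -> conv Rel v v' -> conv Rel (u ++ v) (u' ++ v').
Proof.
move=> uu' vv'; apply: (@conv_trans _ _ (u' ++ v)).
  elim: uu' v {v' vv'}=> {u u'} [w|u v _ ih|u v w _ ih1 _ ih2|u l v|u r v Rr] t.
  - exact: conv_refl.
  - exact: conv_sym.
  - exact: conv_trans (ih1 t) (ih2 t).
  - by rewrite -!catA (catA [:: l; _]); apply: conv_cancel.
  - by rewrite -!catA; apply: conv_relator.
elim: vv' u' {u uu'} => {v v'} [w|u v _ ih|u v w _ ih1 _ ih2|u l v|u r v Rr] t.
- exact: conv_refl.
- exact: conv_sym.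
- exact: conv_trans (ih1 t) (ih2 t).
- by rewrite !(catA t); apply: conv_cancel.
- by rewrite !(catA t); apply: conv_relator.
Qed.

Lemma conv_mul_inverse w : conv Rel (w ++ inverse_word w) [::].
Proof.
elim/last_ind: w => [|w l ih]; first exact: conv_refl.
rewrite -cats1 inverse_word_cat -catA.
apply: conv_trans ih; exact: (conv_cancel Rel w l (inverse_word w)).
Qed.

Lemma conv_inverse_mul w : conv Rel (inverse_word w ++ w) [::].
Proof. by have := conv_mul_inverse (inverse_word w); rewrite inverse_wordK. Qed.

Lemma conv_inverse u v : conv Rel u v -> conv Rel (inverse_word u) (inverse_word v).
Proof.
move=> uv; apply: (@conv_trans _ _ (inverse_word u ++ (v ++ inverse_word v))).
  rewrite -[X in conv _ X _]cats0; apply: conv_cat; first exact: conv_refl.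
  by apply: conv_sym; apply: conv_mul_inverse.
rewrite catA -[X in conv _ _ X]cat0s; apply: conv_cat; last exact: conv_refl.
apply: conv_trans (conv_inverse_mul u).
by apply: conv_cat; [apply: conv_refl|apply: conv_sym].
Qed.

Definition conv_rel : rel word := fun u v => `[< conv Rel u v >].

Lemma conv_rel_refl : reflexive conv_rel.
Proof. by move=> u; apply/asboolP; apply: conv_refl. Qed.

Lemma conv_rel_sym : symmetric conv_rel.
Proof. by move=> u v; apply/asboolP/asboolP; apply: conv_sym. Qed.

Lemma conv_rel_trans : transitive conv_rel.
Proof.
by move=> v u w /asboolP uv /asboolP vw; apply/asboolP; apply: conv_trans vw.
Qed.

Definition conv_equiv := EquivRel conv_rel conv_rel_refl conv_rel_sym conv_rel_trans.

Definition presented : Type := {eq_quot conv_equiv}%qT.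

HB.instance Definition _ := Choice.copy presented {eq_quot conv_equiv}%qT.

Definition class_of (w : word) : presented := (\pi_({eq_quot conv_equiv}%qT) w)%qT.
Definition rep (g : presented) : word := repr (g : {eq_quot conv_equiv}%qT).

Lemma repK g : class_of (rep g) = g.
Proof. exact: reprK. Qed.

Lemma class_ofP u v : class_of u = class_of v <-> conv Rel u v.
Proof.
split=> [/eqP|uv]; first by rewrite eqmodE => /asboolP.
by apply/eqP; rewrite eqmodE; apply/asboolP.
Qed.

Lemma conv_rep w : conv Rel (rep (class_of w)) w.
Proof. by apply/class_ofP; rewrite repK. Qed.

Definition presented_one := class_of [::].
Definition presented_mul (g h : presented) := class_of (rep g ++ rep h).
Definition presented_inv (g : presented) := class_of (inverse_word (rep g)).

Let mulE u v : presented_mul (class_of u) (class_of v) = class_of (u ++ v).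
Proof. by apply/class_ofP; apply: conv_cat; apply: conv_rep. Qed.

Let invE u : presented_inv (class_of u) = class_of (inverse_word u).
Proof. by apply/class_ofP; apply: conv_inverse; apply: conv_rep. Qed.

Lemma presented_mulA : associative presented_mul.
Proof.
by move=> g h k; rewrite -(repK g) -(repK h) -(repK k) !mulE catA.
Qed.

Lemma presented_mul1g : left_id presented_one presented_mul.
Proof. by move=> g; rewrite -(repK g) mulE. Qed.

Lemma presented_mulg1 : right_id presented_one presented_mul.
Proof. by move=> g; rewrite -(repK g) mulE cats0. Qed.

Lemma presented_mulVg : left_inverse presented_one presented_inv presented_mul.
Proof.
move=> g; rewrite -(repK g) invE mulE.
by apply/class_ofP; apply: conv_inverse_mul.
Qed.

Lemma presented_mulgV : right_inverse presented_one presented_inv presented_mul.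
Proof.
move=> g; rewrite -(repK g) invE mulE.
by apply/class_ofP; apply: conv_mul_inverse.
Qed.

HB.instance Definition _ := isGroup.Build presented presented_mulA
  presented_mul1g presented_mulg1 presented_mulVg presented_mulgV.

Lemma class_of_cat u v : class_of (u ++ v) = (class_of u * class_of v)%g.
Proof. by rewrite -mulE. Qed.

Lemma class_of_nil : class_of [::] = 1%g.
Proof. by []. Qed.

Lemma class_of_inverse u : class_of (inverse_word u) = (class_of u)^-1%g.
Proof. by rewrite -invE. Qed.

Lemma class_of_commutator u v :
  class_of (commutator_word u v) = commg (class_of u) (class_of v).
Proof. by rewrite /commutator_word !class_of_cat !class_of_inverse. Qed.

Lemma class_of_quotient u v :
  class_of (u ++ inverse_word v) = 1%g -> class_of u = class_of v.
Proof.
rewrite class_of_cat class_of_inverse => uv.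
by apply: (mulIg (class_of v)^-1%g); rewrite mulgV.
Qed.

Lemma class_of_relator r : Rel r -> class_of r = 1%g.
Proof.
by move=> Rr; apply/class_ofP; have := conv_relator [::] [::] Rr; rewrite cats0.
Qed.

Lemma class_of_flatten_nseq r k :
  class_of (flatten (nseq k r)) = (class_of r ^+ k)%g.
Proof. by elim: k => //= k ih; rewrite class_of_cat ih expgS. Qed.

End Congruence.

(** The arguments about resolutions treat the presented group as an abstract
    group [G] with a section [rep] of the evaluation [cl] of words. *)
Record presentation Rel (G : groupType) (cl : word -> G) (rep : G -> word) : Prop :=
  Presentation {
    presentation_cat : forall u v, cl (u ++ v) = (cl u * cl v)%g;
    presentation_nil : cl [::] = 1%g;
    presentation_rep : cancel rep cl;
    presentation_conv : forall u v, cl u = cl v <-> conv Rel u v }.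

Lemma presented_presentation Rel : presentation Rel (class_of Rel) (@rep Rel).
Proof.
by split; [apply: class_of_cat|apply: class_of_nil|apply: repK|apply: class_ofP].
Qed.

Section Presentation.
Context (Rel : word -> Prop) (G : groupType) (cl : word -> G) (rep : G -> word).
Context (presG : presentation Rel cl rep).

Lemma presentation_cancellation l : cl (cancellation l) = 1%g.
Proof.
rewrite -(presentation_nil presG); apply/(presentation_conv presG).
exact: (conv_cancel Rel [::] l [::]).
Qed.

Lemma presentation_relator r : Rel r -> cl r = 1%g.
Proof.
move=> Rr; rewrite -(presentation_nil presG); apply/(presentation_conv presG).
by have := conv_relator [::] [::] Rr; rewrite cats0.
Qed.

End Presentation.

End Words.

(** * The group ring and Fox derivatives *)

Section GroupRingExtension.
Context (R : pzRingType) (G : groupType).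
Local Notation A := (group_ring R G).

Definition gelt (g : G) : A := << 1 *g g >>.

Lemma mul_monomial (c c' : R) (g g' : G) :
  (<< c *g g >> : A) * << c' *g g' >> = << c * c' *g (g * g')%g >>.
Proof. exact: group_ring_mulUU. Qed.

Lemma geltM g h : gelt (g * h)%g = gelt g * gelt h.
Proof. by rewrite /gelt mul_monomial mulr1. Qed.

Lemma augmentation_gelt g : augmentation (gelt g) = 1.
Proof. exact: augmentationU. Qed.

Lemma augmentationB (a b : A) : augmentation (a - b) = augmentation a - augmentation b.
Proof. by apply/eqP; rewrite eq_sym subr_eq -augmentationD subrK. Qed.

Lemma group_ring_ind (Q : A -> Prop) :
  Q 0 -> (forall a b, Q a -> Q b -> Q (a + b)) ->
  (forall c g, Q << c *g g >>) -> forall a, Q a.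
Proof.
move=> Q0 QD QU a; rewrite (monalgE a).
by elim/big_ind: _ => // g _; apply: QU.
Qed.

Section Extension.
Context (V : lmodType A) (f : G -> V).

(** The [R]-linear extension of [f], for the action of [R] on [V] through the
    multiples of the identity of [A]. *)
Definition extend (a : A) : V := \sum_(g <- msupp a) (<< a@_g *g 1%g >> : A) *: f g.

Lemma extendEw (d : {fset G}) (a : A) :
  msupp a `<=` d -> extend a = \sum_(g <- d) (<< a@_g *g 1%g >> : A) *: f g.
Proof.
move=> le; apply: big_fset_incl => // g _ /mcoeff_outdom ->.
by rewrite monalgU0 scale0r.
Qed.

Lemma extendD a b : extend (a + b) = extend a + extend b.
Proof.
rewrite (extendEw (msuppD_le a b)) (extendEw (fsubsetUl (msupp a) (msupp b))).
rewrite (extendEw (fsubsetUr (msupp a) (msupp b))) -big_split /=.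
by apply: eq_bigr => g _; rewrite mcoeffD monalgUD scalerDl.
Qed.

Lemma extend0 : extend 0 = 0.
Proof. by rewrite /extend msupp0 big_seq_fset0. Qed.

Lemma extendN a : extend (- a) = - extend a.
Proof. by apply/eqP; rewrite -addr_eq0 -extendD addNr extend0. Qed.

Lemma extendB a b : extend (a - b) = extend a - extend b.
Proof. by rewrite extendD extendN. Qed.

Lemma extend_sum (I : Type) (s : seq I) (a : I -> A) :
  extend (\sum_(i <- s) a i) = \sum_(i <- s) extend (a i).
Proof. exact: (big_morph extend extendD extend0). Qed.

Lemma extend_monomial c g : extend << c *g g >> = (<< c *g 1%g >> : A) *: f g.
Proof. by rewrite (extendEw msuppU_le) big_seq_fset1 mcoeffUU. Qed.

End Extension.

Lemma linear_extend (V W : lmodType A) (h : {linear V -> W}) (f : G -> V) a :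
  h (extend f a) = extend (h \o f) a.
Proof. by rewrite linear_sum; apply: eq_bigr => g _; rewrite linearZ. Qed.

Definition augmentation_map : {linear 'rV[A]_1 -> trivial_module R G} :=
  combination (fun _ => (1 : R) : trivial_module R G).

Lemma augmentation_mapE (u : 'rV[A]_1) : augmentation_map u = augmentation (u 0 0).
Proof. by rewrite /= /combination big_ord1; apply: mulr1. Qed.

Lemma augmentation_map_surj : surjective augmentation_map.
Proof.
move=> c; exists (const_mx << (c : R) *g 1%g >>).
by rewrite augmentation_mapE mxE augmentationU.
Qed.

Lemma trivial_monomial_scale c g (m : trivial_module R G) :
  (<< c *g g >> : A) *: m = c * (m : R).
Proof. by congr (_ * _); apply: augmentationU. Qed.

End GroupRingExtension.

Section Fox.
Context (R : pzRingType) (X : finType) (Rel : word X -> Prop).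
Context (G : groupType) (cl : word X -> G) (rep : G -> word X).
Context (presG : presentation Rel cl rep).
Local Notation A := (group_ring R G).
Local Notation letter := (X * bool)%type.
Local Notation n := #|{: letter}|.
Let cl_cat := presentation_cat presG.
Let cl_nil := presentation_nil presG.
Let repK := presentation_rep presG.

Definition letter_basis (l : letter) : 'rV[A]_n := 'e_(enum_rank l).

Definition boundary : {linear 'rV[A]_n -> 'rV[A]_1} :=
  combination (fun i => const_mx (gelt R (cl [:: enum_val i]) - 1)).

Lemma boundaryE u : boundary u 0 0 = \sum_i u 0 i * (gelt R (cl [:: enum_val i]) - 1).
Proof. by rewrite /= /combination summxE; apply: eq_bigr => i _; rewrite !mxE. Qed.

(** The letters [l] and [l^-1] get independent basis vectors, so that this is
    the derivation on the free monoid of words; the price is that the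
    cancelling pairs have non-zero derivative and count as relators. *)
Fixpoint fox (w : word X) : 'rV[A]_n :=
  if w is l :: w' then letter_basis l + gelt R (cl [:: l]) *: fox w' else 0.

Lemma fox_cat u v : fox (u ++ v) = fox u + gelt R (cl u) *: fox v.
Proof.
elim: u => [|l u ih] /=; first by rewrite cl_nil add0r scale1r.
by rewrite ih scalerDr scalerA -geltM -cl_cat addrA.
Qed.

Lemma fox_letter l : fox [:: l] = letter_basis l.
Proof. by rewrite /= scaler0 addr0. Qed.

Lemma boundary_letter l : boundary (letter_basis l) = const_mx (gelt R (cl [:: l]) - 1).
Proof. by rewrite /= combination_delta enum_rankK. Qed.

Lemma boundary_fox w : boundary (fox w) = const_mx (gelt R (cl w) - 1).
Proof.
elim: w => [|l w ih].
  by rewrite linear0 cl_nil subrr; apply/matrixP => i j; rewrite !mxE.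
rewrite [fox _]/= linearD linearZ /= boundary_letter ih.
apply/matrixP => i j; rewrite !mxE -(cat1s l w) cl_cat geltM mulrBr mulr1.
by rewrite addrC subrKA.
Qed.

(** The explicit preimage extends [g |-> fox (rep g)] linearly: the boundary of
    [fox (rep g)] is [g - 1]. *)
Lemma augmentation_exact : exact_at boundary (augmentation_map R G).
Proof.
move=> x; rewrite augmentation_mapE; split=> [ax0|[u <-]]; last first.
  rewrite boundaryE augmentation_sum big1 // => i _.
  by rewrite augmentationM augmentationB augmentation_gelt augmentation1 subrr mulr0.
exists (extend (fun g => fox (rep g)) (x 0 0)); rewrite linear_extend.
apply/matrixP => i j; rewrite !ord1.
have -> (a : A) : extend (boundary \o (fun g => fox (rep g))) a 0 0 =
    a - << augmentation a *g 1%g >>.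
  elim/group_ring_ind: a => [|a b iha ihb|c g].
  - by rewrite extend0 augmentation0 monalgU0 subr0 mxE.
  - by rewrite extendD mxE iha ihb augmentationD monalgUD opprD addrACA.
  rewrite extend_monomial augmentationU [X in _ *: X]boundary_fox repK !mxE.
  by rewrite mulrBr mulr1 mul_monomial mulr1 mul1g.
by rewrite ax0 monalgU0 subr0.
Qed.

Lemma fox_insert u r v :
  cl r = 1%g -> fox (u ++ r ++ v) - fox (u ++ v) = gelt R (cl u) *: fox r.
Proof.
move=> r1; rewrite !fox_cat r1 scale1r scalerDr.
by rewrite opprD addrACA subrr add0r addrK.
Qed.

Lemma fox_power r k : cl r = 1%g -> fox (flatten (nseq k r)) = fox r *+ k.
Proof. by move=> r1; elim: k => //= k ih; rewrite fox_cat ih r1 scale1r mulrS. Qed.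

End Fox.

(** * A presentation whose relators are rational consequences of finitely many *)

Section RationallyFinitelyPresented.
Context (F : fieldType) (X : finType) (Rel : word X -> Prop).
Context (G : groupType) (cl : word X -> G) (rep : G -> word X).
Context (presG : presentation Rel cl rep) (rels : seq (word X)).
Local Notation A := (group_ring F G).
Local Notation letter := (X * bool)%type.
Local Notation n := #|{: letter}|.
Local Notation foxd := (fox F cl).

Let cl_cat := presentation_cat presG.
Let cl_nil := presentation_nil presG.
Let repK := presentation_rep presG.
Let cl_conv := presentation_conv presG.

Let cl_cancellation := presentation_cancellation presG.
Let cl_relator := presentation_relator presG.

(** The attaching words of the 2-cells. The edges labelled [l] and [l^-1] being
    distinct, cancelling pairs bound cells as well. *)
Definition two_cell_words := rels ++ map (@cancellation X) (enum {: letter}).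

Definition two_cell_boundary : {linear 'rV[A]_(size two_cell_words) -> 'rV[A]_n} :=
  combination (fun j => foxd (tnth (in_tuple two_cell_words) j)).

Definition bounds (v : 'rV[A]_n) : Prop := exists c, two_cell_boundary c = v.

Lemma bounds0 : bounds 0.
Proof. by exists 0; rewrite linear0. Qed.

Lemma boundsD u v : bounds u -> bounds v -> bounds (u + v).
Proof. by move=> [c <-] [d <-]; exists (c + d); rewrite linearD. Qed.

Lemma boundsZ a u : bounds u -> bounds (a *: u).
Proof. by move=> [c <-]; exists (a *: c); rewrite linearZ. Qed.

Lemma boundsN u : bounds u -> bounds (- u).
Proof. by move=> [c <-]; exists (- c); rewrite linearN. Qed.

Lemma boundsBD u v u' v' :
  bounds (u - u') -> bounds (v - v') -> bounds (u + v - (u' + v')).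
Proof. by move=> bu bv; rewrite opprD addrACA; apply: boundsD. Qed.

Lemma bounds_two_cell r : r \in two_cell_words -> bounds (foxd r).
Proof.
move=> /(tnthP (in_tuple two_cell_words)) [j ->].
by exists 'e_j; rewrite /= combination_delta.
Qed.

Lemma bounds_cancellation l : bounds (foxd (cancellation l)).
Proof.
by apply: bounds_two_cell; rewrite mem_cat map_f ?orbT // mem_enum.
Qed.

Lemma conv_bounds (Rel' : word X -> Prop) u v :
  (forall r, Rel' r -> cl r = 1%g /\ bounds (foxd r)) ->
  conv Rel' u v -> bounds (foxd u - foxd v).
Proof.
move=> Rel'P; elim=> {u v} [w|u v _ ih|u v w _ ih1 _ ih2|u l v|u r v Rr].
- by rewrite subrr; apply: bounds0.
- by rewrite -opprB; apply: boundsN.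
- by rewrite -(subrKA (foxd v)); apply: boundsD.
- rewrite (fox_insert F presG) ?cl_cancellation //.
  by apply: boundsZ; apply: bounds_cancellation.
have [r1 br] := Rel'P r Rr.
by rewrite (fox_insert F presG) //; apply: boundsZ.
Qed.

Hypothesis rels_sub : {in rels, forall r, Rel r}.
Hypothesis rels_power : forall r, Rel r ->
  exists2 k, k%:R != 0 :> F & conv (fun r => r \in rels) (flatten (nseq k r)) [::].

(** Since [r] is trivial in [G], the derivative of its [k]-th power is [k] times
    its own, and [k] is invertible in [F]. *)
Lemma bounds_relator r : Rel r -> bounds (foxd r).
Proof.
move=> Rr; have [k k0 rk] := rels_power Rr.
have : bounds (foxd (flatten (nseq k r)) - foxd [::]).
  apply: (conv_bounds _ rk) => s rs; split.
    by apply: cl_relator; apply: rels_sub.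
  by apply: bounds_two_cell; rewrite mem_cat rs.
rewrite [foxd [::]]/= subr0 (fox_power F presG) ?cl_relator // -scaler_nat.
move=> /(boundsZ << k%:R^-1 *g 1%g >>); rewrite scalerA.
(* Division by [k] takes place in [A], through the multiples of its identity. *)
have kA : (<< k%:R^-1 *g 1%g >> : A) * k%:R = 1.
  have -> : k%:R = << k%:R *g 1%g >> :> A.
    elim: (k) => [|j ih]; first by rewrite monalgU0.
    by rewrite !mulrS ih monalgUD.
  by rewrite mul_monomial mulVf // mulg1.
by rewrite kA scale1r.
Qed.

(** The crossed homomorphism [g |-> foxd (rep g)] is well defined modulo
    [bounds], and its linear extension is modulo [bounds] a left inverse of
    [boundary], as a comparison on [g *: e_l] shows. *)
Lemma boundary_exact : exact_at two_cell_boundary (boundary F cl).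
Proof.
have tc j : cl (tnth (in_tuple two_cell_words) j) = 1%g.
  have /= := mem_tnth j (in_tuple two_cell_words).
  rewrite mem_cat => /orP[/rels_sub/cl_relator//|/mapP[l _ ->]].
  exact: cl_cancellation.
move=> u; split=> [bu0|[c <-]]; last first.
  rewrite /two_cell_boundary linear_combination /combination big1 // => j _.
  rewrite /= (boundary_fox F presG) tc subrr.
  by apply/matrixP => i i'; rewrite !mxE mulr0.
have wd w : bounds (foxd w - foxd (rep (cl w))).
  apply: (@conv_bounds Rel); last by apply/cl_conv; rewrite repK.
  by move=> r Rr; rewrite cl_relator //; split=> //; apply: bounds_relator.
pose T (a : A) := extend (fun g => foxd (rep g)) a.
have key l (a : A) :
    bounds (a *: letter_basis F G l - T (a * (gelt F (cl [:: l]) - 1))).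
  have [y yE] : {y | y = gelt F (cl [:: l]) - 1} by eexists.
  rewrite -yE; elim/group_ring_ind: a => [|a b iha ihb|c g].
  - by rewrite scale0r mul0r /T extend0 subrr; apply: bounds0.
  - by rewrite scalerDl mulrDl /T extendD; exact: boundsBD iha ihb.
  rewrite yE mulrBr mulr1 mul_monomial mulr1 /T extendB !extend_monomial -scalerBr.
  have -> : (<< c *g g >> : A) = (<< c *g 1%g >> : A) * gelt F g.
    by rewrite mul_monomial mulr1 mul1g.
  rewrite -scalerA -scalerBr; apply: boundsZ.
  have := wd (rep g ++ [:: l]).
  rewrite (fox_cat F presG) fox_letter cl_cat repK.
  by rewrite opprB addrA [X in X - _]addrC.
suff : bounds (u - T (boundary F cl u 0 0)).
  by rewrite bu0 mxE /T extend0 subr0.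
rewrite boundaryE /T extend_sum {1}[u]row_sum_delta -sumrB.
elim/big_ind: _ => [||i _]; [exact: bounds0|exact: boundsD|].
by have := key (enum_val i) (u 0 i); rewrite /letter_basis enum_valK.
Qed.

(** The resolution is the cellular chain complex of the Cayley complex with 2-cells
    for [rels] and the cancelling pairs only: a relator with a power that follows
    from [rels] need not be filled in, if the exponent is invertible in [F]. *)
Lemma type_FP2_of_presentation : type_FP 2 F G.
Proof.
pose dim i := match i with 0 => 1 | 1 => n | 2 => size two_cell_words | _ => 0 end%N.
pose d i : {linear 'rV[A]_(dim i.+1) -> 'rV[A]_(dim i)} :=
  match i with
  | 0 => boundary F cl
  | 1 => two_cell_boundary
  | _ => \0
  end%N.
exists (fun i => 'rV[A]_(dim i)), d, (augmentation_map F G); split.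
- by move=> i _; split; [apply: row_projective|apply: row_finitely_generated].
- exact: augmentation_map_surj.
- by move=> _; apply: (augmentation_exact presG).
by case=> // _; apply: boundary_exact.
Qed.

End RationallyFinitelyPresented.

(** * An obstruction to type FP_2 from central extensions *)

Section Obstruction.
Context (F : fieldType) (X : finType) (Rel : word X -> Prop).
Context (G : groupType) (cl : word X -> G) (rep : G -> word X).
Context (presG : presentation Rel cl rep).
Local Notation A := (group_ring F G).
Local Notation letter := (X * bool)%type.
Local Notation n := #|{: letter}|.

Let cl_cat := presentation_cat presG.
Let cl_nil := presentation_nil presG.
Let repK := presentation_rep presG.
Let cl_conv := presentation_conv presG.

(** On the words that are trivial in [G] such a [lam] is a homomorphism to [F]
    that is invariant under conjugation, the datum of a central extension of [G]
    by [F]. Being defined on all words, it needs no separate clause for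
    conjugation. *)
Definition relation_functional (lam : word X -> F) : Prop :=
  (forall w u w', cl u = 1%g -> lam (w ++ u ++ w') = lam (w ++ w') + lam u) /\
  (forall l, lam (cancellation l) = 0).

Section Functional.
Context (lam : word X -> F) (lamP : relation_functional lam).

Let cl_cancellation := presentation_cancellation presG.

Let cl_mul_inverse u v : cl u = cl v -> cl (u ++ inverse_word v) = 1%g.
Proof.
move=> uv; rewrite cl_cat uv -cl_cat -cl_nil; apply/cl_conv.
exact: conv_mul_inverse.
Qed.

Let cl_inverse_mul u : cl (inverse_word u ++ u) = 1%g.
Proof.
by have := cl_mul_inverse (erefl (cl (inverse_word u))); rewrite inverse_wordK.
Qed.

Let lam_nil : lam [::] = 0.
Proof.
have /= /eqP := lamP.1 [::] [::] [::] cl_nil.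
by rewrite -subr_eq0 opprD addNKr oppr_eq0 => /eqP.
Qed.

Let lam_mul_inverse w : lam (w ++ inverse_word w) = 0.
Proof.
elim/last_ind: w => [|w l ih]; first exact: lam_nil.
rewrite -cats1 inverse_word_cat -catA.
have := lamP.1 w (cancellation l) (inverse_word w) (cl_cancellation l).
by rewrite lamP.2 addr0 ih.
Qed.

Let lam_split p w k t : cl w = k ->
  lam (p ++ w ++ t) = lam (w ++ inverse_word (rep k)) + lam (p ++ rep k ++ t).
Proof.
move=> wk.
have kk : lam (inverse_word (rep k) ++ rep k) = 0.
  by have := lam_mul_inverse (inverse_word (rep k)); rewrite inverse_wordK.
have := lamP.1 (p ++ w) _ t (cl_inverse_mul (rep k)).
rewrite kk addr0 -!catA => <-.
have := lamP.1 p (w ++ inverse_word (rep k)) (rep k ++ t).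
rewrite -!catA addrC => -> //.
by apply: cl_mul_inverse; rewrite repK.
Qed.

(** The words [rep g] choose a path from 1 to each vertex of the Cayley graph; this
    is the value of [lam] on the loop that they form with the edge from [g]
    labelled [l]. *)
Definition letter_defect (l : letter) (g : G) : trivial_module F G :=
  lam (rep g ++ l :: inverse_word (rep (g * cl [:: l])%g)).

Definition cochain (u : 'rV[A]_n) : trivial_module F G :=
  \sum_i extend (letter_defect (enum_val i)) (u 0 i).

Lemma cochainD u v : cochain (u + v) = cochain u + cochain v.
Proof. by rewrite -big_split /=; apply: eq_bigr => i _; rewrite mxE extendD. Qed.

Lemma cochain0 : cochain 0 = 0.
Proof. by rewrite /cochain big1 // => i _; rewrite mxE extend0. Qed.

Lemma cochain_letter g l :
  cochain (gelt F g *: letter_basis F G l) = letter_defect l g.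
Proof.
rewrite /cochain (bigD1 (enum_rank l)) //= big1 => [|i /negPf il]; last first.
  by rewrite !mxE il andbF mulr0 extend0.
by rewrite addr0 !mxE !eqxx mulr1 extend_monomial enum_rankK scale1r.
Qed.

(** Along the path [w] the defects telescope. The constant accounts for [rep 1],
    which need not be the empty word. *)
Lemma cochain_fox w :
  cochain (fox F cl w) =
  lam (w ++ inverse_word (rep (cl w))) - lam (inverse_word (rep 1%g)) :> F.
Proof.
elim/last_ind: w => [|w l ih]; first by rewrite cochain0 cl_nil subrr.
rewrite -cats1 (fox_cat F presG) cochainD ih fox_letter cochain_letter.
rewrite addrAC; congr (_ - _); rewrite cl_cat /letter_defect.
by rewrite -catA [RHS](@lam_split [::] w (cl w)).
Qed.

(** The 2-cocycle of the central extension attached to [lam]. *)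
Definition multiplication_defect (h g : G) : trivial_module F G :=
  lam (rep h ++ rep g ++ inverse_word (rep (h * g)%g)).

(** Both sides come from evaluating [lam] on one word, cut in two ways. *)
Lemma letter_defect_translate h l g :
  letter_defect l (h * g)%g =
  letter_defect l g + (multiplication_defect h (g * cl [:: l])%g
                       - multiplication_defect h g).
Proof.
pose t := rep h ++ rep g ++ l :: inverse_word (rep (h * g * cl [:: l])%g).
have tE1 : lam t = multiplication_defect h g + letter_defect l (h * g)%g :> F.
  rewrite /t catA (@lam_split [::] _ (h * g)%g) ?cl_cat ?repK //.
  by rewrite -catA.
have tE2 : lam t = letter_defect l g + multiplication_defect h (g * cl [:: l])%g :> F.
  rewrite /t -cat1s (catA (rep g)) (@lam_split _ _ (g * cl [:: l])%g) ?cl_cat ?repK //.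
  by rewrite -catA /multiplication_defect mulgA.
by apply: (addrI (multiplication_defect h g)); rewrite addrCA subrKC -tE2 -tE1.
Qed.

(** The failure of invariance under [G] depends on the boundary alone, so that
    [cochain] is invariant on cycles. *)
Lemma cochain_translate h u :
  cochain (gelt F h *: u) =
  cochain u + extend (multiplication_defect h) (boundary F cl u 0 0).
Proof.
rewrite boundaryE extend_sum -big_split /=; apply: eq_bigr => i _.
rewrite mxE; move: (u 0 i) (enum_val i) => a l {u i}.
have [y yE] : {y | y = gelt F (cl [:: l]) - 1} by eexists.
rewrite -yE; elim/group_ring_ind: a => [|a b iha ihb|c g].
- by rewrite mulr0 mul0r !extend0 addr0.
- by rewrite mulrDr mulrDl !extendD iha ihb addrACA.
rewrite yE mulrBr mulr1 !mul_monomial mul1r mulr1 extendB !extend_monomial.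
by rewrite letter_defect_translate scalerDr scalerBr.
Qed.

Lemma cochain_constant c u :
  cochain ((<< c *g 1%g >> : A) *: u) = c * (cochain u : F).
Proof.
rewrite mulr_sumr; apply: eq_bigr => i _; rewrite mxE.
elim/group_ring_ind: (u 0 i) => [|a b iha ihb|d g].
- by rewrite mulr0 extend0 [RHS]mulr0.
- by rewrite mulrDr !extendD iha ihb [RHS]mulrDr.
by rewrite mul_monomial mul1g !extend_monomial !trivial_monomial_scale mulrA.
Qed.

Lemma cochain_cycle a u :
  boundary F cl u = 0 -> cochain (a *: u) = augmentation a * (cochain u : F).
Proof.
move=> bu0; elim/group_ring_ind: a => [|a b iha ihb|c g].
- by rewrite scale0r cochain0 augmentation0 mul0r.
- by rewrite scalerDl cochainD iha ihb augmentationD mulrDl.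
have -> : (<< c *g g >> : A) = (<< c *g 1%g >> : A) * gelt F g.
  by rewrite mul_monomial mulr1 mul1g.
rewrite -scalerA cochain_constant cochain_translate bu0 mxE extend0 addr0.
by rewrite augmentationM augmentationU augmentation_gelt mulr1.
Qed.

End Functional.

(** Relations have derivatives that are cycles, and the cycles form a finitely
    generated module when [G] is of type FP_2. On cycles each [cochain] factors
    through the coinvariants of this module, of dimension at most its number
    [d] of generators. *)
Lemma type_FP2_bound : type_FP 2 F G ->
  exists d, forall m (lam : 'I_m -> word X -> F) (u : 'I_m -> word X),
    (forall i, relation_functional (lam i)) -> (forall j, cl (u j) = 1%g) ->
    (forall i j, lam i (u j) = (i == j)%:R) -> (m <= d)%N.
Proof.
move=> [P [dP [eps [projP eps_surj ex0 ex1]]]].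
have [d [z [bz gen]]] := cycles_finitely_generated
  (projP 0%N isT).1 (projP 0%N isT).2 (projP 1%N isT).1 (projP 1%N isT).2
  (projP 2%N isT).2 eps_surj (ex0 isT) (ex1 0%N isT)
  (@augmentation_map_surj F G) (augmentation_exact presG).
exists d => m lam u lamP clu lam_u.
have bu j : boundary F cl (fox F cl (u j)) = 0.
  rewrite (boundary_fox F presG) clu subrr.
  by apply/matrixP => i k; rewrite !mxE.
have [c cE] := fin_all_exists (fun j => gen _ (bu j)).
pose C : 'M[F]_(m, d) := \matrix_(j, t) augmentation (c j 0 t).
pose L : 'M[F]_(d, m) := \matrix_(t, i) (cochain (lam i) (z t) : F).
(* The matrix of the pairing is the identity, and factors through [F^d]. *)
suff CL : C *m L = 1%:M.
  by rewrite -(mxrank1 F m) -CL (leq_trans (mxrankM_maxl _ _)) // rank_leq_col.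
apply/matrixP => j i; rewrite !mxE eq_sym -lam_u.
have /esym := cochain_fox (lamP i) (u j); rewrite clu.
have -> : lam i (u j ++ inverse_word (rep 1%g)) =
          lam i (inverse_word (rep 1%g)) + lam i (u j).
  by rewrite -((lamP i).1 [::] (u j)).
rewrite addrC addKr => ->; rewrite cE /combination.
rewrite (big_morph (cochain (lam i)) (cochainD (lam i)) (cochain0 (lam i))).
by apply: eq_bigr => t _; rewrite !mxE (cochain_cycle (lamP i)).
Qed.

End Obstruction.

(** * Steinberg relations indexed by words *)

Section CommutatorIdentities.
Context (P : groupType).
Local Open Scope group_scope.
Implicit Types x y z : P.

Lemma commuteP x y : commute x y <-> [~ x, y] = 1.
Proof. by split=> [/commgP/eqP|/eqP/commgP]. Qed.

Lemma commute_commg x y z : commute x y -> commute x z -> commute x [~ y, z].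
Proof.
move=> xy xz; rewrite /commg /conjg.
by do ?[apply: commuteM|apply: commuteV].
Qed.

Lemma commg_mull x y z : commute y [~ x, z] -> [~ x * y, z] = [~ x, z] * [~ y, z].
Proof.
move=> c; have -> : [~ x * y, z] = y^-1 * [~ x, z] * y * [~ y, z].
  by rewrite /commg /conjg !invgM !mulgA !mulgK.
by rewrite -(mulgA y^-1) -c mulKg.
Qed.

Lemma commg_mulr x y z : commute z [~ x, y] -> [~ x, y * z] = [~ x, z] * [~ x, y].
Proof.
move=> c; have -> : [~ x, y * z] = [~ x, z] * (z^-1 * [~ x, y] * z).
  by rewrite /commg /conjg !invgM !mulgA !mulgK.
by rewrite -(mulgA z^-1) -c mulKg.
Qed.

(** A case of the Hall-Witt identity. *)
Lemma commg_assoc x y z :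
  commute x z -> commute [~ x, y] [~ y, z] -> commute [~ x, y] x ->
  [~ x, [~ y, z]] = [~ [~ x, y], z].
Proof.
have [v vE] : {v | v = [~ x, y]} by eexists.
rewrite -vE; set t := [~ y, z] => xz vX vx.
have vt : commute v [~ x, t] by apply: commute_commg.
have tx : t ^ x = t * [~ v^-1, z].
  have yx : y ^ x = y * v^-1.
    by rewrite vE /commg /conjg !invgM !invgK !mulgA mulgV mul1g.
  have zx : z ^ x = z by rewrite /conjg -xz mulKg.
  rewrite {1}/t conjRg yx zx commg_mull //.
  by apply: commute_sym; apply: commuteV; apply: commute_sym.
have xt : [~ x, t] = v * [~ v, z] * v^-1.
  have -> : [~ x, t] = (t ^ x)^-1 * t by rewrite /commg /conjg !invgM !invgK !mulgA.
  rewrite tx invgM mulgVK /commg /conjg !invgM !invgK !mulgA.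
  by rewrite mulgV mul1g.
by apply: (mulgI v); rewrite vt xt mulgVK.
Qed.

End CommutatorIdentities.

Section WordSteinberg.
Context (P : groupType) (I : finType) (L : eqType).
Hypothesis I_large : (4 < #|I|)%N.
Context (e : I -> I -> L -> P).
Local Open Scope group_scope.

Lemma fresh (s : seq I) : (size s <= 4)%N -> exists j, j \notin s.
Proof.
move=> s4; apply/existsP; rewrite -[[exists j, _]]negbK negb_exists.
apply/forallP => all_s.
have : (#|I| <= size s)%N.
  apply: leq_trans (card_size s); apply/subset_leq_card/subsetP => j _.
  by have := all_s j; rewrite negbK.
by rewrite leqNgt (leq_ltn_trans s4).
Qed.

Definition third (i k : I) : I := odflt i [pick j | (j != i) && (j != k)].

Lemma thirdP i k : third i k != i /\ third i k != k.
Proof.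
rewrite /third; case: pickP => [j /andP[] //|no].
have [//|j] := @fresh [:: i; k].
by rewrite !inE negb_or no.
Qed.

(** Plays the part of [e i k (a b c)] for a non-empty word [a b c], as if letters
    could be multiplied. On the empty word the value is a convention. *)
Fixpoint root (i k : I) (w : seq L) : P :=
  match w with
  | [::] => 1
  | a :: [::] => e i k a
  | a :: w' => [~ e i (third i k) a, root (third i k) k w']
  end.

Hypothesis e_commute : forall i j k l a b,
  i != j -> k != l -> j != k -> i != l -> commute (e i j a) (e k l b).

Hypothesis e_middle : forall i j j' k a b,
  i != k -> j != i -> j != k -> j' != i -> j' != k ->
  [~ e i j a, e j k b] = [~ e i j' a, e j' k b].

Lemma root_cons i k a w : w != [::] ->
  root i k (a :: w) = [~ e i (third i k) a, root (third i k) k w].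
Proof. by case: w. Qed.

Local Arguments root : simpl never.

Definition middle_free (w : seq L) := forall i k a m,
  i != k -> m != i -> m != k -> root i k (a :: w) = [~ e i m a, root m k w].

Definition letter_commutes (w : seq L) := forall i j k l b,
  i != j -> k != l -> j != k -> i != l -> commute (root i j w) (e k l b).

(** Five indices are what the induction uses up: rebracketing through [n] makes
    the middle index [m] visible to [e_middle], and the commutation needed for
    that takes a further index [q] distinct from [i], [k], [m] and [n]. *)
Lemma root_induction (w : seq L) :
  w != [::] -> middle_free w /\ letter_commutes w.
Proof.
pose good w' := w' != [::] -> middle_free w' /\ letter_commutes w'.
suff main d : (forall w', (size w' < d)%N -> good w') ->
    forall w', size w' = d -> good w'.
  have [d] := ubnP (size w); elim: d w => // d ih w.
  rewrite ltnS leq_eqVlt => /orP[/eqP wd|wd]; last exact: ih.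
  by apply: (main d) wd => w'; apply: ih.
move=> ih [//|b w'] wd _.
have [->|w'0] := eqVneq w' [::].
  split=> [i k a m ik mi mk|i j k l c]; last exact: e_commute.
  by rewrite root_cons //=; have [ti tk] := thirdP i k; apply: e_middle.
have {wd} w'd : (size w' < d)%N by rewrite -wd.
have [middle_w' comm_w'] := ih w' w'd w'0.
have comm : letter_commutes (b :: w').
  move=> i j k l c ij kl jk il.
  have [m] := @fresh [:: i; j; k; l] isT.
  rewrite !inE !negb_or => /and4P[mi mj mk ml].
  rewrite (middle_w' i j b m) //; apply: commute_sym; apply: commute_commg.
    by apply: commute_sym; apply: e_commute; rewrite // eq_sym.
  by apply: commute_sym; apply: comm_w'; rewrite // eq_sym.
split=> // i k a m ik mi mk.
have through n m' : m' != i -> m' != k -> n != i -> n != k -> n != m' ->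
    [~ e i m' a, root m' k (b :: w')] = [~ [~ e i m' a, e m' n b], root n k w'].
  move=> m'i m'k ni nk nm'.
  rewrite (middle_w' m' k b n) // 1?eq_sym //.
  have [q] := @fresh [:: i; k; m'; n] isT.
  rewrite !inE !negb_or => /and4P[qi qk qm' qn].
  apply: commg_assoc.
  - by apply: commute_sym; apply: comm_w'; rewrite // eq_sym.
  - rewrite -(middle_w' m' k b n) // 1?eq_sym //.
    rewrite (e_middle (j' := q)) // 1?eq_sym //.
    by apply: commute_sym; apply: commute_commg; apply: comm; rewrite // eq_sym.
  - rewrite (e_middle (j' := q)) // 1?eq_sym //.
    by apply: commute_sym; apply: commute_commg; apply: e_commute; rewrite // eq_sym.
rewrite root_cons //; have [] := thirdP i k; move: (third i k) => m' m'i m'k.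
have [n] := @fresh [:: i; k; m; m'] isT.
rewrite !inE !negb_or => /and4P[ni nk nm nm'].
by rewrite !(through n) // (e_middle (j' := m)) // eq_sym.
Qed.

Lemma root_middle i k a m w : w != [::] ->
  i != k -> m != i -> m != k -> root i k (a :: w) = [~ e i m a, root m k w].
Proof. by move=> /root_induction[+ _]; apply. Qed.

Lemma root_commute u v i j k l : u != [::] -> v != [::] ->
  i != j -> k != l -> j != k -> i != l -> commute (root i j u) (root k l v).
Proof.
move=> u0; have [_ comm_u] := root_induction u0.
elim: v i j k l => // b v ih i j k l _ ij kl jk il.
have [->|v0] := eqVneq v [::]; first exact: comm_u.
have [m] := @fresh [:: i; j; k; l] isT.
rewrite !inE !negb_or => /and4P[mi mj mk ml].
rewrite (root_middle b v0 kl mk ml); apply: commute_commg.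
  by apply: comm_u; rewrite // eq_sym.
by apply: ih; rewrite // eq_sym.
Qed.

(** The Steinberg relation for all words, from finitely many relations if [I] and
    [L] are finite. *)
Lemma root_cat u v i j k : u != [::] -> v != [::] ->
  i != j -> j != k -> i != k -> root i k (u ++ v) = [~ root i j u, root j k v].
Proof.
move=> + v0; elim: u i j k => // a u ih i j k _ ij jk ik.
have [->|u0] := eqVneq u [::]; first by apply: root_middle; rewrite // eq_sym.
have uv0 : u ++ v != [::] by case: (u) u0.
have [m] := @fresh [:: i; j; k] isT.
rewrite !inE !negb_or => /and3P[mi mj mk].
have uE : root i j (a :: u) = [~ e i m a, root m j u] by apply: root_middle.
rewrite cat_cons (root_middle a uv0 ik mi mk) uE (ih _ j) // 1?eq_sym //.
have uvE : root m k (u ++ v) = [~ root m j u, root j k v].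
  by rewrite (ih _ j) // 1?eq_sym.
apply: commg_assoc; rewrite -?uE -?uvE.
- by apply: (@root_commute [:: a]); rewrite // eq_sym.
- by apply: root_commute; rewrite // eq_sym.
by apply: (@root_commute _ [:: a]); rewrite // eq_sym.
Qed.

Lemma root_cat_eq1l u v : u != [::] -> v != [::] ->
  (forall i k, i != k -> root i k u = 1) ->
  forall i k, i != k -> root i k (u ++ v) = 1.
Proof.
move=> u0 v0 u1 i k ik; have [j] := @fresh [:: i; k] isT.
rewrite !inE negb_or => /andP[ji jk].
by rewrite (@root_cat u v i j k) // 1?u1 ?comm1g // eq_sym.
Qed.

Lemma root_cat_eq1r u v : u != [::] -> v != [::] ->
  (forall i k, i != k -> root i k v = 1) ->
  forall i k, i != k -> root i k (u ++ v) = 1.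
Proof.
move=> u0 v0 v1 i k ik; have [j] := @fresh [:: i; k] isT.
rewrite !inE negb_or => /andP[ji jk].
by rewrite (@root_cat u v i j k) // 1?v1 ?commg1 // eq_sym.
Qed.

Lemma root_cat_additive u w w1 w2 v :
  u != [::] -> w != [::] -> w1 != [::] -> w2 != [::] -> v != [::] ->
  (forall i k, i != k -> root i k w = root i k w1 * root i k w2) ->
  forall i k, i != k ->
  root i k (u ++ w ++ v) = root i k (u ++ w1 ++ v) * root i k (u ++ w2 ++ v).
Proof.
move=> u0 w0 w10 w20 v0 ww i k ik.
have cat0 s t : s != [::] :> seq L -> s ++ t != [::] by case: s.
have wv j l : j != l -> root j l (w ++ v) = root j l (w1 ++ v) * root j l (w2 ++ v).
  move=> jl; have [m] := @fresh [:: j; l] isT.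
  rewrite !inE negb_or => /andP[mj ml].
  rewrite !(@root_cat _ v j m l) // 1?eq_sym // ww 1?eq_sym //.
  apply: commg_mull; rewrite -root_cat // 1?eq_sym //.
  by apply: root_commute; rewrite ?cat0 // eq_sym.
have [j] := @fresh [:: i; k] isT; rewrite !inE negb_or => /andP[ji jk].
rewrite !(@root_cat u _ i j k) ?cat0 // 1?eq_sym // wv //.
have c s t : s != [::] -> t != [::] -> commute (root i k s) (root j k t).
  by move=> s0 t0; apply: root_commute; rewrite // eq_sym.
rewrite commg_mulr -?root_cat ?cat0 // 1?eq_sym //.
  by apply: root_commute; rewrite ?cat0 // eq_sym.
by apply: commute_sym; apply: c; rewrite cat0.
Qed.

Section Euler.
Context (s x y z : L).
Hypothesis root_sx : forall i k, i != k ->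
  root i k [:: s; x] = root i k [:: x; s] * root i k [:: x].
Hypothesis root_ys : forall i k, i != k -> root i k [:: y; s] = 1.
Hypothesis root_sz : forall i k, i != k -> root i k [:: s; z] = 1.

Lemma root_euler i k m n : i != k ->
  root i k (y :: nseq m x ++ s :: nseq n x ++ [:: z]) =
  root i k (y :: nseq (m + n) x ++ [:: z]) ^+ n.
Proof.
move=> ik; elim: n m => [|n ih] m.
  by rewrite -cat_cons; apply: root_cat_eq1r.
have := @root_cat_additive (y :: nseq m x) [:: s; x] [:: x; s] [:: x]
  (nseq n x ++ [:: z]).
rewrite /= => -> //; last by case: (n).
have E t : nseq m x ++ x :: t = nseq m.+1 x ++ t.
  by elim: (m) => //= k' ->.
by rewrite !E ih (catA (nseq m.+1 x)) -nseqD addSnnS expgSr.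
Qed.

(** In a ring with [s x = x s + x], [y s = 0] and [s z = 0] one would compute
    [0 = y s x^n z = y x^n s z + n y x^n z = n y x^n z]. *)
Lemma root_torsion i k n : i != k ->
  root i k (y :: nseq n x ++ [:: z]) ^+ n = 1.
Proof.
move=> ik; rewrite -(root_euler 0) //.
by apply: (@root_cat_eq1l [:: y; s]) => //; case: n.
Qed.

End Euler.

End WordSteinberg.

(** * The group *)

(** Encoded as pairs, the four letters come with their finite type structure. *)
Definition symbol := (bool * bool)%type.
Definition s_ : symbol := (false, false).
Definition x_ : symbol := (false, true).
Definition y_ : symbol := (true, false).
Definition z_ : symbol := (true, true).

Definition generator := ('I_5 * 'I_5 * symbol)%type.

Definition gen (i k : 'I_5) (a : symbol) : word generator := [:: ((i, k, a), true)].

Fixpoint root_word (i k : 'I_5) (w : seq symbol) : word generator :=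
  match w with
  | [::] => [::]
  | a :: [::] => gen i k a
  | a :: w' => commutator_word (gen i (third i k) a) (root_word (third i k) k w')
  end.

(** The letters [e_ii] exist only because the generators form a product type. *)
Definition diagonal_relators : seq (word generator) :=
  [seq gen t.1 t.1 t.2 | t <- enum {: 'I_5 * symbol}].

Definition commuting_relators : seq (word generator) :=
  [seq let: (i, j, k, l, a, b) := t in commutator_word (gen i j a) (gen k l b) |
     t <- enum {: 'I_5 * 'I_5 * 'I_5 * 'I_5 * symbol * symbol} &
     let: (i, j, k, l, _, _) := t in [&& i != j, k != l, j != k & i != l]].

Definition middle_relators : seq (word generator) :=
  [seq let: (i, j, j', k, a, b) := t in
       commutator_word (gen i j a) (gen j k b) ++
       inverse_word (commutator_word (gen i j' a) (gen j' k b)) |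
     t <- enum {: 'I_5 * 'I_5 * 'I_5 * 'I_5 * symbol * symbol} &
     let: (i, j, j', k, _, _) := t in
     [&& i != k, j != i, j != k, j' != i & j' != k]].

Definition off_diagonal : seq ('I_5 * 'I_5) :=
  [seq t <- enum {: 'I_5 * 'I_5} | t.1 != t.2].

(** The relations [s x = x s + x], [y s = 0] and [s z = 0]. *)
Definition euler_relators : seq (word generator) :=
  [seq root_word t.1 t.2 [:: s_; x_] ++
       inverse_word (root_word t.1 t.2 [:: x_; s_] ++ root_word t.1 t.2 [:: x_])
     | t <- off_diagonal] ++
  [seq root_word t.1 t.2 [:: y_; s_] | t <- off_diagonal] ++
  [seq root_word t.1 t.2 [:: s_; z_] | t <- off_diagonal].

Definition base_relators : seq (word generator) :=
  diagonal_relators ++ commuting_relators ++ middle_relators ++ euler_relators.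

Definition torsion_word (n : nat) : word generator :=
  root_word 0 1 (y_ :: nseq n x_ ++ [:: z_]).

Definition relator (w : word generator) : Prop :=
  w \in base_relators \/ exists n, w = torsion_word n.+1.

Lemma mem_off_diagonal i k : (i, k) \in off_diagonal = (i != k).
Proof. by rewrite mem_filter mem_enum andbT. Qed.

Section Torsion.
Local Notation Rel := (fun w => w \in base_relators).
Local Notation cl := (class_of Rel).
Local Notation e := (fun i k a => cl (gen i k a)).

Lemma class_of_root_word i k w : cl (root_word i k w) = root e i k w.
Proof.
elim: w i k => // a [//|b w] ih i k.
have -> : root_word i k [:: a, b & w] =
    commutator_word (gen i (third i k) a) (root_word (third i k) k (b :: w)) by [].
by rewrite class_of_commutator ih.
Qed.

Lemma base_commute i j k l a b :
  i != j -> k != l -> j != k -> i != l -> commute (e i j a) (e k l b).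
Proof.
move=> ij kl jk il; apply/commuteP; rewrite -class_of_commutator.
apply: class_of_relator; rewrite /base_relators !mem_cat.
apply/orP; right; apply/orP; left; apply/mapP.
by exists (i, j, k, l, a, b); rewrite // mem_filter mem_enum ij kl jk il.
Qed.

Lemma base_middle i j j' k a b :
  i != k -> j != i -> j != k -> j' != i -> j' != k ->
  commg (e i j a) (e j k b) = commg (e i j' a) (e j' k b).
Proof.
move=> ik ji jk j'i j'k; rewrite -!class_of_commutator.
apply: class_of_quotient.
apply: class_of_relator; rewrite /base_relators !mem_cat.
do 2![apply/orP; right]; apply/orP; left; apply/mapP.
by exists (i, j, j', k, a, b); rewrite // mem_filter mem_enum ik ji jk j'i j'k.
Qed.

Lemma euler_relator_base w : w \in euler_relators -> w \in base_relators.
Proof. by rewrite !mem_cat => ->; rewrite !orbT. Qed.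

Lemma torsion_word_power n : conv Rel (flatten (nseq n (torsion_word n))) [::].
Proof.
apply/class_ofP; rewrite class_of_flatten_nseq class_of_nil class_of_root_word.
apply: (root_torsion _ base_commute base_middle (s := s_)); rewrite ?card_ord //.
- move=> i k ik; rewrite -!class_of_root_word -class_of_cat.
  apply: class_of_quotient.
  apply: class_of_relator; apply: euler_relator_base; rewrite !mem_cat.
  by apply/orP; left; apply/mapP; exists (i, k); rewrite ?mem_off_diagonal.
- move=> i k ik; rewrite -class_of_root_word.
  apply: class_of_relator; apply: euler_relator_base.
  rewrite !mem_cat; apply/orP; right; apply/orP; left.
  by apply/mapP; exists (i, k); rewrite ?mem_off_diagonal.
move=> i k ik; rewrite -class_of_root_word.
apply: class_of_relator; apply: euler_relator_base.
rewrite !mem_cat; do 2![apply/orP; right].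
by apply/mapP; exists (i, k); rewrite ?mem_off_diagonal.
Qed.

End Torsion.

Lemma type_FP2_rat : type_FP 2 rat (presented relator).
Proof.
apply: (type_FP2_of_presentation (presented_presentation relator)
  (rels := base_relators)) => [r rb|r [rb|[n ->]]]; first by left.
  exists 1%N; first exact: oner_neq0.
  exact: (@conv_relator _ (fun r => r \in base_relators) [::] r [::] rb).
by exists n.+1; [rewrite Num.Theory.pnatr_eq0|apply: torsion_word_power].
Qed.

(** * Matrix representations with central torsion *)

Section ElementaryMatrices.
Context (B : nzRingType) (rho : symbol -> B).
Local Notation M := 'M[B]_5.
Implicit Types (i j k l : 'I_5) (b c : B).

Definition entry_mx i j b : M :=
  \matrix_(i', j') (if (i' == i) && (j' == j) then b else 0).

Lemma mul_entry_mx i j k l b c :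
  entry_mx i j b * entry_mx k l c = if j == k then entry_mx i l (b * c) else 0.
Proof.
apply/matrixP => i' l'; rewrite !mxE (bigD1 j) //= big1 => [|j' /negPf jj'].
  rewrite addr0 !mxE eqxx andbT; case: (j =P k) => _; rewrite ?mxE /=.
    by case: (i' == i); case: (l' == l); rewrite ?mulr0 ?mul0r.
  by rewrite mulr0.
by rewrite !mxE jj' andbF mul0r.
Qed.

Lemma entry_mxD i j b c : entry_mx i j (b + c) = entry_mx i j b + entry_mx i j c.
Proof. by apply/matrixP => i' j'; rewrite !mxE; case: ifP; rewrite ?addr0. Qed.

Lemma entry_mx0 i j : entry_mx i j 0 = 0.
Proof. by apply/matrixP => i' j'; rewrite !mxE if_same. Qed.

Lemma entry_mxN i j b : entry_mx i j (- b) = - entry_mx i j b.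
Proof. by apply/eqP; rewrite -addr_eq0 -entry_mxD addNr entry_mx0. Qed.

Definition transvection i j b : M := 1 + entry_mx i j b.

Lemma transvectionD i j b c : i != j ->
  transvection i j b * transvection i j c = transvection i j (b + c).
Proof.
move=> /negPf ij; rewrite /transvection mulrDl mul1r mulrDr mulr1 mul_entry_mx.
by rewrite eq_sym ij addr0 entry_mxD addrA addrAC.
Qed.

Lemma transvection0 i j : transvection i j 0 = 1.
Proof. by rewrite /transvection entry_mx0 addr0. Qed.

Lemma transvection_commute i j k l b c : j != k -> i != l ->
  transvection i j b * transvection k l c = transvection k l c * transvection i j b.
Proof.
move=> /negPf jk /negPf il.
rewrite /transvection !mulrDl !mulrDr !mul1r !mulr1 !mul_entry_mx jk eq_sym il.
by rewrite !addr0 addrAC.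
Qed.

Lemma transvection_commutator i j k b c : i != j -> j != k -> i != k ->
  transvection i j (- b) * transvection j k (- c) *
  (transvection i j b * transvection j k c) = transvection i k (b * c).
Proof.
move=> /negPf ij /negPf jk /negPf ik.
have [ji kj ki] : [/\ (j == i) = false, (k == j) = false & (k == i) = false].
  by rewrite !(eq_sym _ i) (eq_sym k) ij jk ik.
have E (s t : B) : transvection i j s * transvection j k t =
    1 + (entry_mx i j s + entry_mx j k t + entry_mx i k (s * t)).
  rewrite /transvection mulrDl mul1r mulrDr mulr1 mul_entry_mx eqxx -!addrA.
  by congr (_ + _); rewrite addrCA.
rewrite !E mulrDl mul1r mulrDr mulr1 !mulrDl !mulrDr !mul_entry_mx.
rewrite !eqxx ?ij ?jk ?ik ?ji ?kj ?ki mulrNN mulNr !entry_mxN !addr0 !add0r.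
rewrite /transvection -!addrA subrr addr0; congr (_ + _).
rewrite [X in _ + X]addrCA addrCA.
by rewrite (addrA (entry_mx i j b)) -opprD subrr addr0.
Qed.

Definition letter_mx (l : generator * bool) : M :=
  let: (i, j, a, sgn) := l in
  if i == j then 1 else transvection i j (if sgn then rho a else - rho a).

Definition eval_mx (w : word generator) : M := \prod_(l <- w) letter_mx l.

Lemma eval_mx_cat u v : eval_mx (u ++ v) = eval_mx u * eval_mx v.
Proof. exact: big_cat. Qed.

Lemma eval_mx_nil : eval_mx [::] = 1.
Proof. exact: big_nil. Qed.

Lemma eval_mx_gen i j a : i != j -> eval_mx (gen i j a) = transvection i j (rho a).
Proof. by move=> /negPf ij; rewrite /eval_mx big_seq1 /= ij. Qed.

Lemma eval_mx_cancellation (l : generator * bool) : eval_mx (cancellation l) = 1.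
Proof.
case: l => [[[i j] a] sgn]; rewrite /eval_mx big_cons big_seq1 /=.
have [_|ij] := eqVneq i j; first by rewrite mulr1.
by rewrite transvectionD //; case: sgn; rewrite /= ?addrN ?addNr transvection0.
Qed.

Lemma eval_mx_mul_inverse w : eval_mx w * eval_mx (inverse_word w) = 1.
Proof.
elim/last_ind: w => [|w l ih]; first by rewrite eval_mx_nil mulr1.
rewrite -cats1 inverse_word_cat !eval_mx_cat mulrA -(mulrA (eval_mx w)).
by rewrite -eval_mx_cat (eval_mx_cancellation l) mulr1.
Qed.

Lemma eval_mx_inverse_mul w : eval_mx (inverse_word w) * eval_mx w = 1.
Proof. by have := eval_mx_mul_inverse (inverse_word w); rewrite inverse_wordK. Qed.

Lemma eval_mx_inverse w i j b : i != j ->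
  eval_mx w = transvection i j b -> eval_mx (inverse_word w) = transvection i j (- b).
Proof.
move=> ij wE; rewrite -[RHS]mulr1 -(eval_mx_mul_inverse w) mulrA wE.
by rewrite transvectionD // addNr transvection0 mul1r.
Qed.

Lemma eval_mx_quotient u v :
  eval_mx u = eval_mx v -> eval_mx (u ++ inverse_word v) = 1.
Proof. by move=> uv; rewrite eval_mx_cat uv eval_mx_mul_inverse. Qed.

Lemma eval_mx_commuting u v : eval_mx u * eval_mx v = eval_mx v * eval_mx u ->
  eval_mx (commutator_word u v) = 1.
Proof.
move=> uv; rewrite /commutator_word !eval_mx_cat uv.
rewrite (mulrA (eval_mx (inverse_word v))) eval_mx_inverse_mul mul1r.
exact: eval_mx_inverse_mul.
Qed.

Lemma eval_mx_commutator u v i j k b c : i != j -> j != k -> i != k ->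
  eval_mx u = transvection i j b -> eval_mx v = transvection j k c ->
  eval_mx (commutator_word u v) = transvection i k (b * c).
Proof.
move=> ij jk ik uE vE; rewrite /commutator_word catA !eval_mx_cat.
rewrite (eval_mx_inverse ij uE) (eval_mx_inverse jk vE) uE vE.
exact: transvection_commutator.
Qed.

Lemma eval_mx_root_word i k w : w != [::] -> i != k ->
  eval_mx (root_word i k w) = transvection i k (\prod_(a <- w) rho a).
Proof.
elim: w i k => // a [|b w] ih i k _ ik.
  by rewrite big_seq1 /= eval_mx_gen.
have -> : root_word i k [:: a, b & w] =
    commutator_word (gen i (third i k) a) (root_word (third i k) k (b :: w)) by [].
have [ti tk] := @thirdP 'I_5 (eq_leq (esym (card_ord 5))) i k.
rewrite big_cons; apply: (@eval_mx_commutator _ _ i (third i k)) => //.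
- by rewrite eq_sym.
- by rewrite eval_mx_gen // eq_sym.
exact: ih.
Qed.

Hypothesis rho_sx : rho s_ * rho x_ = rho x_ * rho s_ + rho x_.
Hypothesis rho_ys : rho y_ * rho s_ = 0.
Hypothesis rho_sz : rho s_ * rho z_ = 0.

Lemma eval_mx_base_relator r : r \in base_relators -> eval_mx r = 1.
Proof.
rewrite /base_relators /euler_relators !mem_cat.
move=> /or4P[||| /or3P[]] /mapP[].
- by move=> [i a] _ ->; rewrite /eval_mx big_seq1 /= eqxx.
- move=> [[[[[i j] k] l] a] b]; rewrite mem_filter mem_enum andbT.
  move=> /and4P[ij kl jk il] ->; apply: eval_mx_commuting.
  by rewrite !eval_mx_gen // transvection_commute.
- move=> [[[[[i j] j'] k] a] b]; rewrite mem_filter mem_enum andbT.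
  move=> /and5P[ik ji jk j'i j'k] ->; apply: eval_mx_quotient.
  have E m : m != i -> m != k -> eval_mx (commutator_word (gen i m a) (gen m k b)) =
      transvection i k (rho a * rho b).
    move=> mi mk; have im : i != m by rewrite eq_sym.
    by apply: (@eval_mx_commutator _ _ i m k); rewrite ?eval_mx_gen.
  by rewrite !E.
- move=> [i k]; rewrite mem_off_diagonal => ik ->; apply: eval_mx_quotient.
  rewrite eval_mx_cat !eval_mx_root_word // !big_cons !big_nil !mulr1.
  by rewrite transvectionD //= rho_sx.
- move=> [i k]; rewrite mem_off_diagonal => ik ->.
  by rewrite eval_mx_root_word // !big_cons !big_nil mulr1 rho_ys transvection0.
- move=> [i k]; rewrite mem_off_diagonal => ik ->.
  by rewrite eval_mx_root_word // !big_cons !big_nil mulr1 rho_sz transvection0.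
Qed.

Lemma eval_mx_torsion_word n :
  eval_mx (torsion_word n) = transvection 0 1 (rho y_ * rho x_ ^+ n * rho z_).
Proof.
rewrite eval_mx_root_word // big_cons big_cat big_seq1 /= mulrA.
congr (transvection _ _ (_ * _ * _)).
by elim: n => [|n ih]; rewrite /= ?big_nil // big_cons ih exprS.
Qed.

Section Central.
Context (v : B).
Hypothesis rho_v : forall a, rho a * v = 0.
Hypothesis v_rho : forall a, v * rho a = 0.

(** Each letter acts as [1 + a E_ij] with [a v = v a = 0], which makes [1 + v E_01]
    central. *)
Lemma eval_mx_fix_left w : eval_mx w * entry_mx 0 1 v = entry_mx 0 1 v.
Proof.
elim: w => [|[[[i j] a] sgn] w ih]; first by rewrite eval_mx_nil mul1r.
rewrite -cat1s eval_mx_cat -mulrA ih /eval_mx big_seq1 /=.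
case: ifP => _; first by rewrite mul1r.
rewrite mulrDl mul1r mul_entry_mx; case: sgn; rewrite ?mulNr rho_v ?oppr0 entry_mx0.
  by rewrite if_same addr0.
by rewrite if_same addr0.
Qed.

Lemma eval_mx_fix_right w : entry_mx 0 1 v * eval_mx w = entry_mx 0 1 v.
Proof.
elim: w => [|[[[i j] a] sgn] w ih]; first by rewrite eval_mx_nil mulr1.
rewrite -cat1s eval_mx_cat mulrA -[RHS]ih; congr (_ * _); rewrite /eval_mx big_seq1 /=.
case: ifP => _; first by rewrite mulr1.
rewrite mulrDr mulr1 mul_entry_mx; case: sgn; rewrite ?mulrN v_rho ?oppr0 entry_mx0.
  by rewrite if_same addr0.
by rewrite if_same addr0.
Qed.

End Central.
End ElementaryMatrices.

Section EulerRepresentation.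
Context (F : fieldType) (n : nat).
Hypothesis n0 : n%:R = 0 :> F.
Local Notation B := 'M[F]_n.+3.
Local Notation pos k := (inord k : 'I_n.+3).

(** On row vectors, with basis [0, 1, ..., n.+2]: [y] goes from 0 to the start of
    the segment [1 .. n.+1], [x] moves one step inside the segment, [z] goes from
    its end to [n.+2], and [s] counts the steps of [x] still to be made in it.
    The word [y x^m z] gets through for [m = n] only. At the start [s] counts [n]
    steps, so that [y s = 0] requires [n] to vanish in [F]. *)
Definition chain_rep (a : symbol) : B :=
  match a with
  | (false, false) =>
      diag_mx (\row_i (if i == 0 then 0 else (n.+1 - i)%:R))
  | (false, true) =>
      \matrix_(i, j) ((0 < i)%N && (j == i.+1 :> nat) && (j < n.+2)%N)%:R
  | (true, false) => delta_mx 0 (pos 1)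
  | (true, true) => delta_mx (pos n.+1) ord_max
  end.

Local Notation v := (delta_mx 0 ord_max : B).

Lemma mul_delta_mxE (i j k l : 'I_n.+3) (A : B) :
  (delta_mx i j * A) k l = (k == i)%:R * A j l.
Proof.
rewrite !mxE (bigD1 j) //= big1 => [|j' /negPf jj'].
  by rewrite !mxE eqxx andbT addr0.
by rewrite !mxE jj' andbF mul0r.
Qed.

Lemma mul_mx_deltaE (i j k l : 'I_n.+3) (A : B) :
  (A * delta_mx i j) k l = A k i * (l == j)%:R.
Proof.
rewrite !mxE (bigD1 i) //= big1 => [|j' /negPf jj'].
  by rewrite !mxE eqxx addr0.
by rewrite !mxE jj' mulr0.
Qed.

Lemma chain_rep_sx :
  chain_rep s_ * chain_rep x_ = chain_rep x_ * chain_rep s_ + chain_rep x_.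
Proof.
apply/matrixP => i j; rewrite -!mulmxE mul_diag_mx mul_mx_diag !mxE.
case: ifP => [/eqP -> | i0]; first by rewrite ltnn /= !mul0r addr0.
case: andP => [[/andP[_ /eqP ji] jn]|_]; last by rewrite mulr0 mul0r addr0.
have -> : (j == 0) = false by apply/eqP => j0; rewrite j0 in ji.
by rewrite mulr1 mul1r natr1 ji subSS subSn // -ltnS -(ltn_add2r 1) !addn1 -ji.
Qed.

Lemma pos_val k : (k < n.+3)%N -> pos k = k :> nat.
Proof. exact: inordK. Qed.

Lemma chain_rep_ys : chain_rep y_ * chain_rep s_ = 0.
Proof.
apply/matrixP => i j; rewrite -mulmxE mul_mx_diag !mxE.
have [->|] := eqVneq j (pos 1); last by rewrite andbF mul0r.
by rewrite pos_val // subSS subn0 n0 if_same mulr0.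
Qed.

Lemma chain_rep_sz : chain_rep s_ * chain_rep z_ = 0.
Proof.
apply/matrixP => i j; rewrite -mulmxE mul_diag_mx !mxE.
have [->|] := eqVneq i (pos n.+1); last by rewrite mulr0.
by rewrite pos_val // subnn if_same mul0r.
Qed.

Lemma chain_rep_power m :
  chain_rep y_ * chain_rep x_ ^+ m = (m <= n)%:R *: delta_mx 0 (pos m.+1).
Proof.
elim: m => [|m ih]; first by rewrite mulr1 scale1r.
rewrite exprSr mulrA ih -scalerAl; apply/matrixP => i j.
rewrite mxE mul_delta_mxE !mxE.
have [mn|nm] := leqP m n; last by rewrite mul0r ltnNge (ltnW nm) mul0r.
rewrite mul1r (pos_val (leqW _ : m.+2 <= n.+3)%N) ?ltnS // -natrM mulnb.
have [mn'|nm'] := ltnP m n.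
  rewrite mul1r; congr (_ && _)%:R; apply/idP/idP => [/andP[/eqP jm _]|/eqP ->].
    by apply/eqP/val_inj; rewrite /= pos_val.
  by rewrite pos_val // eqxx.
rewrite mul0r; case: (i == 0) => //=.
by case: eqP => //= ->; rewrite !ltnS ltnNge nm'.
Qed.

Lemma chain_rep_torsion m :
  chain_rep y_ * chain_rep x_ ^+ m * chain_rep z_ = (m == n)%:R *: v.
Proof.
rewrite chain_rep_power -scalerAl; apply/matrixP => i j.
rewrite mxE mul_delta_mxE !mxE.
have [mn|nm] := leqP m n; last by rewrite mul0r (gtn_eqF nm) mul0r.
have -> : (pos m.+1 == pos n.+1) = (m == n).
  by rewrite -val_eqE /= !pos_val ?eqSS // ltnS leqW.
by rewrite mul1r -!natrM !mulnb; congr (_%:R); rewrite andbCA.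
Qed.

Lemma chain_rep_v a : chain_rep a * v = 0.
Proof.
apply/matrixP => i j; rewrite mul_mx_deltaE [RHS]mxE.
suff -> : chain_rep a i 0 = 0 by rewrite mul0r.
case: a => -[] []; rewrite !mxE.
- by rewrite andbF.
- have p1 : (pos 1 == 0) = false by rewrite -val_eqE /= pos_val.
  by rewrite [0 == _]eq_sym p1 andbF.
- by rewrite andbF.
by case: eqP; rewrite ?mul0rn ?mulr0n.
Qed.

Lemma v_chain_rep a : v * chain_rep a = 0.
Proof.
apply/matrixP => i j; rewrite mul_delta_mxE [RHS]mxE.
suff -> : chain_rep a ord_max j = 0 by rewrite mulr0.
case: a => -[] []; rewrite !mxE.
- by rewrite -val_eqE /= pos_val // gtn_eqF.
- by [].
- case: eqP => [->|_]; last by rewrite andbF.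
  by rewrite /= ltnS ltnNge leqnSn.
have -> : (n.+1 - (ord_max : 'I_n.+3))%N = 0%N by apply/eqP; rewrite subn_eq0 /=.
by rewrite mulr0n mul0rn.
Qed.

Local Notation eval := (eval_mx chain_rep).
Local Notation central c := (entry_mx 0 1 (c *: v)).

Lemma eval_fix_left w c : eval w * central c = central c.
Proof.
by apply: eval_mx_fix_left => a; rewrite -scalerAr chain_rep_v scaler0.
Qed.

Lemma eval_fix_right w c : central c * eval w = central c.
Proof.
by apply: eval_mx_fix_right => a; rewrite -scalerAl v_chain_rep scaler0.
Qed.

Lemma centralD c c' : central (c + c') = central c + central c'.
Proof. by rewrite scalerDl entry_mxD. Qed.

Lemma eval_relator r : relator r -> exists c, eval r = 1 + central c.
Proof.
case=> [rb|[m ->]].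
  exists 0; rewrite scale0r entry_mx0 addr0.
  exact: (eval_mx_base_relator chain_rep_sx chain_rep_ys chain_rep_sz rb).
by exists (m.+1 == n)%:R; rewrite eval_mx_torsion_word chain_rep_torsion.
Qed.

(** A relator evaluates to some [1 + central c], and [central c] absorbs whatever
    stands before and after it. *)
Lemma eval_conv u w : conv relator u w -> exists c, eval u = eval w + central c.
Proof.
elim=> {u w} [w|u w _ [c uE]|u w t _ [c uE] _ [c' wE]|u l w|u r w Rr].
- by exists 0; rewrite scale0r entry_mx0 addr0.
- by exists (- c); rewrite uE scaleNr entry_mxN addrK.
- by exists (c' + c); rewrite uE wE centralD addrA.
- by exists 0; rewrite !eval_mx_cat eval_mx_cancellation mul1r scale0r entry_mx0 addr0.
have [c rE] := eval_relator Rr; exists c.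
by rewrite !eval_mx_cat rE mulrDl mul1r mulrDr eval_fix_right eval_fix_left.
Qed.

(** The coefficient [c] of [1 + central c]. *)
Definition corner (w : word generator) : F := eval w 0 1 0 ord_max.

Lemma corner_add_central (E : 'M[B]_5) c :
  (E + central c) 0 1 0 ord_max = E 0 1 0 ord_max + c.
Proof.
have -> : (E + central c) 0 1 = E 0 1 + c *: v by rewrite !mxE.
by rewrite [LHS]mxE; congr (_ + _); rewrite !mxE !eqxx mulr1.
Qed.

Lemma corner_central c : (1 + central c : 'M[B]_5) 0 1 0 ord_max = c.
Proof. by rewrite corner_add_central !mxE add0r. Qed.

Lemma corner_functional : relation_functional (class_of relator) corner.
Proof.
split=> [w u w' u1|l]; last first.
  by rewrite /corner eval_mx_cancellation !mxE.
have [c uE] : exists c, eval u = 1 + central c.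
  by rewrite -(eval_mx_nil chain_rep); apply/eval_conv/class_ofP.
rewrite /corner [in RHS]uE corner_central !eval_mx_cat uE mulrDl mul1r mulrDr.
by rewrite eval_fix_right eval_fix_left corner_add_central.
Qed.

Lemma corner_torsion_word m : corner (torsion_word m) = (m == n)%:R.
Proof.
rewrite /corner eval_mx_torsion_word chain_rep_torsion.
exact: corner_central.
Qed.

End EulerRepresentation.

Lemma not_type_FP2_Fp (p : nat) : prime p -> ~ type_FP 2 'F_p (presented relator).
Proof.
move=> p_pr /(type_FP2_bound (presented_presentation relator)) [d bound].
have pn k : (p * k)%:R = 0 :> 'F_p by rewrite natrM pchar_Fp_0 // mul0r.
(* Lengths divisible by [p], the only ones at which [corner] is available. *)
suff: (d.+1 <= d)%N by rewrite ltnn.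
apply: (bound d.+1 (fun i => @corner 'F_p (p * i.+1))
  (fun j => torsion_word (p * j.+1))) => [i|j|i j].
- exact: corner_functional (pn _).
- apply: class_of_relator; right; exists (p * j.+1).-1.
  by rewrite prednK // muln_gt0 prime_gt0.
rewrite corner_torsion_word // eqn_pmul2l ?prime_gt0 // eqSS.
by rewrite eq_sym.
Qed.

Theorem corollary1p4 :
  exists G : groupType,
    type_FP 2 rat G /\ forall p : nat, prime p -> ~ type_FP 2 'F_p G.
Proof.
exists (presented relator); split; first exact: type_FP2_rat.
exact: not_type_FP2_Fp.
Qed.
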